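(* Let $\Omega\subset X$ be a nonempty convex set. Then $\Omega$ is quasi-regular under each of the following conditions: (a) $X$ is a finite-dimensional space. (b) $X$ is a real locally convex topological vector space and $\operatorname{int}(\Omega)\ne\emptyset$. (c) $X$ is a real locally convex topological vector space and $\operatorname{ri}(\Omega)\ne\emptyset$. (d) $X$ is a (real) Hilbert space, and $\Omega$ is closed and sequentially normally compact (SNC) with $\operatorname{iri}(\Omega)\ne\emptyset$.
   Context: For a nonempty subset $A$ of a real locally convex topological vector space $X$ with topological dual $X^*$, $\operatorname{cone}(A):=\{ta\mid t\ge 0,\ a\in A\}$ and $\overline{\operatorname{cone}}(A)$ is its closure. For a nonempty convex set $\Omega\subset X$: the relative interior $\operatorname{ri}(\Omega)$ is the set of $x\in\Omega$ for which there is a neighborhood $V$ of $x$ with $V\cap\overline{\operatorname{aff}}(\Omega)\subset\Omega$, where $\overline{\operatorname{aff}}(\Omega)$ is the closure of the affine hull of $\Omega$; the intrinsic relative interior is $\operatorname{iri}(\Omega):=\{x\in\Omega\mid \operatorname{cone}(\Omega-x)\text{ is a linear subspace of }X\}$; the quasi-relative interior is $\operatorname{qri}(\Omega):=\{x\in\Omega\mid \overline{\operatorname{cone}}(\Omega-x)\text{ is a linear subspace of }X\}$. A convex set $\Omega$ is called quasi-regular if $\operatorname{qri}(\Omega)=\operatorname{iri}(\Omega)$. The normal cone to a convex set $\Omega$ at $\bar x\in\Omega$ is $N(\bar x;\Omega):=\{x^*\in X^*\mid \langle x^*,x-\bar x\rangle\le 0\text{ for all }x\in\Omega\}$. A nonempty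 closed convex subset $\Omega$ of a normed space $X$ is SNC at $\bar x\in\Omega$ if for any sequence $\{x_k\}\subset\Omega$ converging to $\bar x$ and any sequence $x_k^*\in N(x_k;\Omega)$ with $x_k^*\to 0$ in the weak$^*$ topology of $X^*$ one has $\|x_k^*\|\to 0$ as $k\to\infty$. $\Omega$ is SNC if it is SNC at every point $\bar x\in\Omega$.
   Formalization: In (a), the finite-dimensional space X is assumed to be Hausdorff (so it is R^n with its usual topology); without this (a) fails, e.g. for [0,1] in R with the indiscrete topology. *)

(* Defs.v *)
From HB Require Import structures.
From mathcomp Require Import all_boot all_order all_algebra.
From mathcomp Require Import all_classical all_reals all_analysis.

Set Implicit Arguments.
Unset Strict Implicit.
Unset Printing Implicit Defensive.

Import Order.TTheory GRing.Theory Num.Theory.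
Import numFieldNormedType.Exports.

Local Open Scope classical_set_scope.
Local Open Scope ring_scope.

Section LinearStructure.
Variables (R : realType) (X : lmodType R).
Implicit Types (A : set X) (x : X).

Definition finite_dimensional : Prop :=
  exists n (e : 'I_n -> X), forall x,
    exists c : 'I_n -> R, x = \sum_(i < n) c i *: e i.

Definition linear_subspace A : Prop := GRing.submod_closed (mem A).

Definition affine_set A : Prop :=
  forall x y (t : R), A x -> A y -> A ((1 - t) *: x + t *: y).

Definition affine_hull A : set X := smallest affine_set A.

Definition translate A x : set X := [set a - x | a in A].

Definition cone A : set X :=
  [set v | exists t a, [/\ 0 <= t, A a & v = t *: a]].

End LinearStructure.

Section RelativeInteriors.
Variables (R : realType) (X : tvsType R).
Implicit Type Omega : set X.

Definition ri Omega : set X :=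
  [set x | Omega x /\
    exists2 V, nbhs x V & V `&` closure (affine_hull Omega) `<=` Omega].

Definition iri Omega : set X :=
  [set x | Omega x /\ linear_subspace (cone (translate Omega x))].

Definition qri Omega : set X :=
  [set x | Omega x /\ linear_subspace (closure (cone (translate Omega x)))].

Definition quasi_regular Omega : Prop := qri Omega = iri Omega.

End RelativeInteriors.

Section SequentialNormalCompactness.
Variables (R : realType) (X : normedModType R).
Implicit Types (Omega : set X) (x : X).

(* The dual of X is the set of continuous elements of {linear X -> R^o}. *)
Definition normal_cone x Omega : set {linear X -> R^o} :=
  [set f : {linear X -> R^o} | continuous f /\ forall y, Omega y -> f (y - x) <= 0].

(* A supremum over a bounded set as soon as f is continuous. *)
Definition dual_norm (f : {linear X -> R^o}) : R :=
  sup [set `|f x| | x in [set x : X | `|x| <= 1]].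

(* The weak* topology on the dual is the topology of pointwise convergence,
   i.e. the one induced by {ptws X -> R^o}. *)
Definition weak_star_cvg0 (f : nat -> {linear X -> R^o}) : Prop :=
  {ptws, (fun k => f k : X -> R^o) @ \oo --> (fun=> 0 : R^o)}.

Definition snc_at Omega (xbar : X) : Prop :=
  forall (x : nat -> X) (f : nat -> {linear X -> R^o}),
    (forall k, Omega (x k)) -> x @ \oo --> xbar ->
    (forall k, normal_cone (x k) Omega (f k)) -> weak_star_cvg0 f ->
    dual_norm (f k) @[k --> \oo] --> (0 : R).

Definition snc Omega : Prop := forall xbar, Omega xbar -> snc_at Omega xbar.

(* A real Hilbert space is a Banach space together with an inner product that
   induces its norm. *)
Definition induces_norm (dot : {dot X for idfun}) : Prop :=
  forall x, `|x| ^+ 2 = dot x x.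

End SequentialNormalCompactness.

(* Main.v *)
Require Import Defs.
From mathcomp Require Import all_boot all_order all_algebra.
From mathcomp Require Import all_classical all_reals all_analysis.
From mathcomp Require Import ring lra.

(* Let [x] be in [qri Omega], [C := cone (Omega - x)] and [L := closure C], a linear
   subspace. Then [C = L] as soon as [C] contains a neighborhood, relative to [L],
   of one of its points [u].
   - If [y] is in [ri Omega], take [u := y - x].
   - In finite dimension, take for [u] the sum of a finite family of [C] that spans
     [C]; coordinates are continuous because the space is Hausdorff.
   - In the Hilbert case, take [u := 0]. Otherwise there are points [x + z k] outside
     [Omega] with [z k] in [L] tending to [0]; projecting them onto [Omega] gives
     unit normals in [L], at points tending to [x], and these converge weakly-* to
     [0], against sequential normal compactness. *)

Set Implicit Arguments.
Unset Strict Implicit.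
Unset Printing Implicit Defensive.

Import Order.TTheory GRing.Theory Num.Theory.
Import numFieldNormedType.Exports.

Local Open Scope classical_set_scope.
Local Open Scope ring_scope.

(** * Convex cones and the cone generated by a translate of a convex set *)

Section ConvexCones.
Variables (R : realType) (X : lmodType R).
Implicit Types (A Omega : set X) (x u v : X).

Lemma linear_subspaceP A :
  linear_subspace A <-> A 0 /\ forall (a : R) u v, A u -> A v -> A (a *: u + v).
Proof.
split=> [[A0 AZD]|[A0 AZD]]; (split; [by move: A0; rewrite !inE|]).
  by move=> a u v Au Av; have := AZD a u v; rewrite !inE; exact.
by move=> a u v; rewrite !inE; exact: AZD.
Qed.

Lemma convex_setP Omega : convex_set Omega -> forall x y (t : R),
  0 <= t -> t <= 1 -> Omega x -> Omega y -> Omega (t *: x + (1 - t) *: y).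
Proof.
move=> cO x y t t0 t1 Ox Oy.
have t01 : Itv.spec (@Itv.num_sem R) (Itv.Real `[0%Z, 1%Z]) t.
  by rewrite /Itv.spec/= /Itv.num_sem/= realE t0/= in_itv/= t0 t1.
have := cO x y (Itv.mk t01).
by rewrite !inE; exact.
Qed.

Definition convex_cone A : Prop :=
  [/\ A 0, forall u v, A u -> A v -> A (u + v)
     & forall (t : R) u, 0 <= t -> A u -> A (t *: u)].

Lemma linear_subspace_convex_cone A : linear_subspace A -> convex_cone A.
Proof.
move=> /linear_subspaceP[A0 AZD]; split=> // [u v Au Av|t u _ Au].
  by rewrite -[u]scale1r; exact: AZD.
by rewrite -[_ *: _]addr0; exact: AZD.
Qed.

Lemma linear_subspaceN A u : linear_subspace A -> A u -> A (- u).
Proof.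
by move=> /linear_subspaceP[A0 AZD] Au; rewrite -[- u]addr0 -scaleN1r; exact: AZD.
Qed.

Lemma linear_subspaceB A u v : linear_subspace A -> A u -> A v -> A (u - v).
Proof.
move=> sA Au Av; have [_ AD _] := linear_subspace_convex_cone sA.
by apply: AD => //; exact: linear_subspaceN.
Qed.

Lemma convex_cone_sum A (I : finType) (c : I -> R) (F : I -> X) :
  convex_cone A -> (forall i, 0 <= c i) -> (forall i, A (F i)) ->
  A (\sum_i c i *: F i).
Proof.
move=> [A0 AD AZ] c0 AF; elim/big_ind: _ => // i _; exact: AZ.
Qed.

Lemma mem_cone_translate Omega x a : Omega a -> cone (translate Omega x) (a - x).
Proof. by move=> Oa; exists 1, (a - x); split; [|exists a|rewrite scale1r]. Qed.

(** The sum t(a - x) + s(b - x) is t + s times w - x, where w is the convex combination of a and b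
    with weights t/(t + s) and s/(t + s); hence the separate case t + s = 0. *)
Lemma cone_convex_cone Omega x : convex_set Omega -> Omega x ->
  convex_cone (cone (translate Omega x)).
Proof.
move=> /convex_setP cO Ox; split.
- by have := mem_cone_translate x Ox; rewrite subrr.
- move=> _ _ [t [_ [t0 [a Oa <-] ->]]] [s [_ [s0 [b Ob <-] ->]]].
  have [ts0|ts_neq0] := eqVneq (t + s) 0.
    have [-> ->] : t = 0 /\ s = 0 by split; lra.
    rewrite !scale0r addr0 -(subrr x); exact: mem_cone_translate.
  have ts_gt0 : 0 < t + s by rewrite lt_neqAle eq_sym ts_neq0 addr_ge0.
  exists (t + s), ((t / (t + s)) *: a + (1 - t / (t + s)) *: b - x); split.
  + exact: ltW.
  + eexists; [|reflexivity]; apply: cO => //.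
      by rewrite divr_ge0// ltW.
    by rewrite ler_pdivrMr// mul1r lerDl.
  + rewrite !scalerBr scalerDr !scalerA mulrBr mulr1 mulrCA divff// mulr1.
    rewrite [t + s - t]addrAC subrr add0r scalerDl opprD.
    by rewrite -!addrA; congr (_ + _); rewrite addrCA.
- move=> t _ t0 [s [a [s0 Oa ->]]]; exists (t * s), a.
  by rewrite mulr_ge0// scalerA.
Qed.

Lemma affine_hull_cone Omega x v : Omega x ->
  cone (translate Omega x) v -> affine_hull Omega (v + x).
Proof.
move=> Ox [t [_ [_ [a Oa <-] ->]]] A [affA OA].
have -> : t *: (a - x) + x = (1 - t) *: x + t *: a.
  by rewrite scalerBr scalerBl scale1r -addrA addrC [- _ + x]addrC.
by apply: affA; exact: OA.
Qed.

End ConvexCones.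

(** * Closures in a topological vector space and a criterion for quasi-regularity *)

Section ClosureTvs.
Variables (R : realType) (X : tvsType R).
Implicit Types (A C Omega V : set X) (x u v : X).

Lemma nbhs_translate x u V : nbhs (x + u) V -> nbhs x [set v | V (v + u)].
Proof.
move=> /nbhsB-/(_ (- u)); rewrite addrC addrK; apply: filterS => v [w Vw <-] /=.
by rewrite addrAC addNr add0r.
Qed.

Lemma closure_linear_subspace A : linear_subspace A -> linear_subspace (closure A).
Proof.
move=> /linear_subspaceP[A0 AZD]; apply/linear_subspaceP; split.
  exact: subset_closure.
move=> a u v clu clv B nB.
have [[A1 A2]/= [nA1 nA2] AB] := add_continuous (a *: u, v) _ nB.
have [[S1 S2]/= [nS1 nS2] SA] := scale_continuous ((a : R^o), u) _ nA1.
have [u' [Au' Su']] := clu _ nS2; have [v' [Av' Av2]] := clv _ nA2.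
exists (a *: u' + v'); split; first exact: AZD.
apply: (AB (_, _)); split => //=; apply: (SA (a, u')); split => //=.
exact: nbhs_singleton.
Qed.

Lemma iri_sub_qri Omega : iri Omega `<=` qri Omega.
Proof. by move=> x [Ox sO]; split=> //; exact: closure_linear_subspace. Qed.

(* If [z] is in the closure [L], then so is [z - u]; approximate it by an element
   [c] of [C]. The error is absorbed by the neighborhood of [u], so that
   [z = (z - c) + c] is a sum of two elements of [C]. *)
Lemma convex_cone_closure_eq C u V : convex_cone C ->
  linear_subspace (closure C) -> C u -> nbhs u V -> V `&` closure C `<=` C ->
  closure C = C.
Proof.
move=> [C0 CD CZ] sL Cu nV VC; apply/seteqP; split; last exact: subset_closure.
move=> z Lz; have Lzu : closure C (z - u).
  by apply: (linear_subspaceB sL) => //; exact: subset_closure.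
have nW : nbhs (z - u) [set c | V (z - c)].
  have := nbhs0N (nbhs_translate (u := u) (x := 0) _).
  move=> /(_ V); rewrite add0r => /(_ nV) nN.
  have := nbhsT (z - u) nN; apply: filterS => _ [_ [v Vv <-] <-] /=.
  by rewrite opprD opprB opprK addrA addrCA subrr addr0 addrC.
have [c [Cc Vzc]] := Lzu _ nW.
rewrite -(subrK c z); apply: CD => //; apply: VC; split=> //.
by apply: (linear_subspaceB sL) => //; exact: subset_closure.
Qed.

(** Since [iri Omega] lies in [qri Omega], only the converse is at stake, and there one relative
    neighborhood makes the cone equal to its closure. *)
Lemma quasi_regularP Omega : convex_set Omega ->
  (forall x, Omega x -> linear_subspace (closure (cone (translate Omega x))) ->
    exists u V, [/\ cone (translate Omega x) u, nbhs u V &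
      V `&` closure (cone (translate Omega x)) `<=` cone (translate Omega x)]) ->
  quasi_regular Omega.
Proof.
move=> cO OV; apply/seteqP; split; last exact: iri_sub_qri.
move=> x [Ox sL]; split=> //; have [u [V [Cu nV VC]]] := OV x Ox sL.
rewrite -(convex_cone_closure_eq _ sL Cu nV VC)//; exact: cone_convex_cone.
Qed.

Lemma ri_quasi_regular Omega : convex_set Omega -> ri Omega !=set0 ->
  quasi_regular Omega.
Proof.
move=> cO [y [Oy [V nV VO]]]; apply: quasi_regularP => // x Ox sL.
exists (y - x), [set v | V (v + x)]; split.
- exact: mem_cone_translate.
- by apply: nbhs_translate; rewrite subrK.
- move=> v [/= Vv Lv]; rewrite -(addrK x v); apply: mem_cone_translate.
  (* It remains to see that [v + x] is in the closure of the affine hull: the points [c + x], with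
     [c] in the cone and close to [v], are in the hull. *)
  apply: VO; split=> // B nB.
  have [c [Cc Bc]] := Lv _ (nbhs_translate nB).
  by exists (c + x); split=> //; exact: affine_hull_cone.
Qed.

Lemma interior_sub_ri Omega : interior Omega `<=` ri Omega.
Proof.
move=> x Ox; split; first exact: interior_subset.
by exists Omega => // v [].
Qed.

End ClosureTvs.

(** * Finite-dimensional spaces: coordinates and quasi-regularity *)

Section FiniteDimension.
Variables (R : realType).

Definition lin_comb (X : lmodType R) n (e : 'I_n -> X) (r : 'rV[R]_n) : X :=
  \sum_(i < n) r 0 i *: e i.

Lemma lin_comb_linear (X : lmodType R) n (e : 'I_n -> X) (a : R) r s :
  lin_comb e (a *: r + s) = a *: lin_comb e r + lin_comb e s.
Proof.
rewrite /lin_comb scaler_sumr -big_split/=; apply: eq_bigr => i _.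
by rewrite !mxE scalerDl scalerA.
Qed.

Lemma lin_comb0 (X : lmodType R) n (e : 'I_n -> X) : lin_comb e 0 = 0.
Proof. by rewrite /lin_comb big1// => i _; rewrite mxE scale0r. Qed.

Lemma lin_combZ (X : lmodType R) n (e : 'I_n -> X) (a : R) r :
  lin_comb e (a *: r) = a *: lin_comb e r.
Proof. by rewrite -[a *: r]addr0 lin_comb_linear lin_comb0 addr0. Qed.

Lemma lin_combB (X : lmodType R) n (e : 'I_n -> X) r s :
  lin_comb e (r - s) = lin_comb e r - lin_comb e s.
Proof.
by rewrite [r - s]addrC -[- s]scaleN1r lin_comb_linear scaleN1r addrC.
Qed.

Lemma lin_comb_mulmx (X : lmodType R) n m (e : 'I_n -> X)
    (r : 'rV[R]_m) (A : 'M[R]_(m, n)) :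
  lin_comb e (r *m A) = \sum_i r 0 i *: lin_comb e (row i A).
Proof.
rewrite /lin_comb; under [RHS]eq_bigr do rewrite scaler_sumr.
rewrite exchange_big/=; apply: eq_bigr => j _.
by rewrite mxE scaler_suml; apply: eq_bigr => i _; rewrite mxE scalerA.
Qed.

(** A spanning family of least size is free: a nontrivial relation would allow one of its vectors to
    be dropped. *)
Lemma lin_comb_basis (X : lmodType R) : finite_dimensional X ->
  exists n (e : 'I_n -> X), (forall x, exists r, x = lin_comb e r) /\
    (forall r, lin_comb e r = 0 -> r = 0).
Proof.
pose P n := `[< exists e : 'I_n -> X, forall x, exists r, x = lin_comb e r >].
move=> [n0 [e0 e0P]]; have exP : exists n, P n.
  exists n0; apply/asboolP; exists e0 => x; have [c ->] := e0P x.
  by exists (\row_i c i); apply: eq_bigr => i _; rewrite mxE.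
case: (ex_minnP exP) => n /asboolP[e eP] n_min; exists n, e; split=> // c c0.
apply/rowP => j; rewrite mxE; apply/eqP; apply: contraT => cj.
case: n => [|n] in e eP n_min c c0 j cj *; first by case: j cj.
have /n_min : P n; last by rewrite ltnn.
apply/asboolP; exists (e \o lift j) => x; have [d ->] := eP x.
(* Subtracting this multiple of the relation [c] cancels the coordinate at [j]. *)
exists (\row_i (d - (d 0 j / c 0 j) *: c) 0 (lift j i)).
rewrite -[LHS]subr0 -(scaler0 _ (d 0 j / c 0 j)) -c0 -lin_combZ -lin_combB.
rewrite /lin_comb (bigD1_ord j)//= !mxE divfK// subrr scale0r add0r.
by apply: eq_bigr => i _; rewrite !mxE.
Qed.

Variables (X : tvsType R) (n : nat) (e : 'I_n -> X).

Lemma lin_comb_continuous : continuous (lin_comb e).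
Proof.
have cont1 i : continuous (fun r : 'rV[R]_n => r 0 i *: e i).
  move=> r B nB.
  have [[S1 S2]/= [nS1 nS2] SB] := scale_continuous ((r 0 i : R^o), e i) _ nB.
  have nS : nbhs r [set s : 'rV[R]_n | S1 (s 0 i)].
    exact: (@coord_continuous R 1 n 0 i r _ nS1).
  apply: filterS nS => s Ss /=.
  by apply: (SB (s 0 i, e i)); split=> //=; exact: nbhs_singleton.
rewrite /lin_comb; elim: (index_enum _) => [|i s IH].
  by under eq_fun do rewrite big_nil; exact: cst_continuous.
under eq_fun do rewrite big_cons.
move=> r B nB; have [[A1 A2]/= [nA1 nA2] AB] := add_continuous (_, _) _ nB.
have n1 : nbhs r [set t : 'rV[R]_n | A1 (t 0 i *: e i)] := cont1 i r _ nA1.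
have n2 : nbhs r [set t : 'rV[R]_n | A2 (\sum_(j <- s) t 0 j *: e j)] := IH r _ nA2.
apply: filterS2 n1 n2 => t t1 t2.
exact: (AB (_, _)).
Qed.

Hypothesis hausX : hausdorff_space X.
Hypothesis e_free : forall r, lin_comb e r = 0 -> r = 0.

(* The image of the unit sphere is compact, hence closed, and misses [0]. *)
Lemma lin_comb_coord_bounded :
  exists M W, [/\ 0 < M, nbhs (0 : X) W & forall r, W (lin_comb e r) -> `|r| <= M].
Proof.
pose S := [set r : 'rV[R]_n | `|r| = 1].
have compS : compact S.
  apply: bounded_closed_compact.
    by exists 1; split=> // M M1 r /= ->; exact: ltW.
  rewrite (_ : S = (fun r => `|r|) @^-1` [set 1])//.
  apply: closed_comp => [r _|]; [exact: norm_continuous|exact: closed_eq].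
have clS : closed (lin_comb e @` S).
  apply: (compact_closed hausX); apply: continuous_compact => //.
  exact/continuous_subspaceT/lin_comb_continuous.
have nU : nbhs (0 *: (0 : X)) (~` (lin_comb e @` S)).
  rewrite scaler0; apply: open_nbhs_nbhs; split; first by rewrite openC.
  move=> [r Sr /e_free r0]; move: Sr; rewrite /S/= r0 normr0 => /eqP.
  by rewrite eq_sym oner_eq0.
(* Near (0, 0) scalar products avoid the image of the sphere. With |r| > 1/d and [lin_comb e r] in
   [W], scaling by 1/|r| would land in that image. *)
have [[D W]/= [nD nW] DW] := scale_continuous ((0 : R^o), (0 : X)) _ nU.
have /nbhs_ballP[d /= d0 dD] := nD.
exists d^-1, W; split=> //; first by rewrite invr_gt0.
move=> r Wr; rewrite leNgt; apply/negP => dr.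
have r0 : 0 < `|r| by rewrite (lt_trans _ dr)// invr_gt0.
apply: (DW (`|r|^-1, lin_comb e r)).
  split=> //=; apply: dD; rewrite -ball_normE /ball_/= sub0r normrN.
  by rewrite normrV ?unitfE ?gt_eqF// normr_id invf_plt.
exists (`|r|^-1 *: r); last by rewrite lin_combZ.
by rewrite /S/= normrZ normrV ?unitfE ?gt_eqF// normr_id mulVf// gt_eqF.
Qed.

(** Continuity at 0 of linear functions of the coordinates. It serves with a cokernel matrix, to
    test membership in a row space, and with a pseudo-inverse, to solve for coefficients. *)
Lemma lin_comb_mulmx_small m (B : 'M[R]_(n, m)) (eps : R) : 0 < eps ->
  exists2 W, nbhs (0 : X) W &
    forall r, W (lin_comb e r) -> forall j, `|(r *m B) 0 j| < eps.
Proof.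
move=> eps0; have [M [W [M0 nW WM]]] := lin_comb_coord_bounded.
pose b : R := \sum_i \sum_j `|B i j|.
have b0 : 0 <= b by apply: sumr_ge0 => i _; exact: sumr_ge0.
(* On d W the coordinates are at most d M in absolute value, so the entries of r B are at most d M b
   < eps. *)
pose d := eps / (M * b + 1).
have Mb : 0 < M * b + 1 by rewrite ltr_pwDr// mulr_ge0// ltW.
have d0 : 0 < d by rewrite divr_gt0.
exists ( *:%R d @` W); first by apply: nbhs0Z => //; rewrite gt_eqF.
move=> r [w Ww wr] j.
have := WM (d^-1 *: r); rewrite lin_combZ -wr scalerA mulVf ?gt_eqF// scale1r.
move=> /(_ Ww); rewrite normrZ gtr0_norm ?invr_gt0// ler_pdivrMl// => rM.
have coordM i : `|r 0 i| <= d * M.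
  by rewrite (le_trans _ rM)// [leRHS]mx_normrE (le_bigmax _ _ (0, i)).
rewrite mxE (le_lt_trans (ler_norm_sum _ _ _))//.
apply: (@le_lt_trans _ _ (d * M * b)).
  rewrite mulr_sumr; apply: ler_sum => i _; rewrite normrM ler_pM//.
  by rewrite (bigD1 j)//= lerDl sumr_ge0.
by rewrite /d -mulrA mulrAC ltr_pdivrMr// ltr_pM2l// ltrDl.
Qed.

End FiniteDimension.

(** Choose finitely many rows in [D] of greatest rank: appending another row of [D] cannot raise the
    rank, so it is already in the row space. *)
Lemma max_rank_rows (F : fieldType) n (D : set 'rV[F]_n) :
  exists m (A : 'M[F]_(m, n)), (forall i, D (row i A)) /\
    forall r, D r -> (r <= A)%MS.
Proof.
pose P k := `[< exists m (A : 'M[F]_(m, n)), (forall i, D (row i A)) /\ \rank A = k >].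
have exP : exists k, P k.
  exists 0%N; apply/asboolP; exists 0%N, 0; split; first by case.
  by rewrite mxrank0.
have P_le k : P k -> (k <= n)%N.
  by move=> /asboolP[m [A [_ <-]]]; exact: rank_leq_col.
case: (ex_maxnP exP P_le) => k /asboolP[m [A [AD rA]]] k_max.
exists m, A; split=> // r Dr.
have /k_max : P (\rank (col_mx A r)).
  apply/asboolP; eexists _, (col_mx A r); split=> // i.
  case: (split_ordP i) => j ->; first by rewrite rowKu.
  by rewrite rowKd (row_id j).
rewrite -rA -addsmxE => rank_le.
have : (A == A + r)%MS by rewrite -(geq_leqif (mxrank_leqif_eq (addsmxSl A r))).
by move=> /eqmxP ->; exact: addsmxSr.
Qed.

Lemma finite_dimensional_quasi_regular (R : realType) (X : tvsType R) (Omega : set X) :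
  hausdorff_space X -> finite_dimensional X -> convex_set Omega ->
  quasi_regular Omega.
Proof.
move=> hausX /lin_comb_basis[n [e [e_span e_free]]] cO.
apply: quasi_regularP => // x Ox sL.
set C := cone _ in sL *; have coneC : convex_cone C by exact: cone_convex_cone.
have [m [A [AC CA]]] := max_rank_rows [set r | C (lin_comb e r)].
(* The row space of [A] is closed: a nonzero entry of [r *m cokermx A] would persist at nearby
   points of [C], where [CA] makes it vanish. *)
have LA r : closure C (lin_comb e r) -> (r <= A)%MS.
  move=> Lr; rewrite submxE; apply/eqP/rowP => j; rewrite [RHS]mxE.
  apply/eqP; apply: contraT => rj.
  have rj0 : 0 < `|(r *m cokermx A) 0 j| by rewrite normr_gt0.
  have [W nW WP] := lin_comb_mulmx_small hausX e_free (cokermx A) rj0.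
  have [|c [Cc Wc]] := Lr [set c | W (c - lin_comb e r)].
    by apply: nbhs_translate; rewrite subrr.
  have [t cE] := e_span c; move: Wc; rewrite /= cE -lin_combB => /WP/(_ j).
  have /eqP tA : t *m cokermx A == 0 by rewrite -submxE; apply: CA; rewrite /= -cE.
  by rewrite mulmxBl tA sub0r mxE normrN ltxx.
(* Near the sum of the vectors given by the rows of [A], a point of the closure is a combination of
   these vectors with coefficients 1 + s, |s| < 1, hence nonnegative. *)
pose one : 'rV[R]_m := const_mx 1.
have [W nW WP] := lin_comb_mulmx_small hausX e_free (pinvmx A) ltr01.
exists (lin_comb e (one *m A)), [set v | W (v - lin_comb e (one *m A))]; split.
- rewrite lin_comb_mulmx; apply: convex_cone_sum => // i.
  by rewrite mxE.
- by apply: nbhs_translate; rewrite subrr.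
move=> v [/= Wv Lv]; have [r vE] := e_span v; rewrite vE in Wv Lv *.
have rA := LA r Lv; rewrite -lin_combB in Wv.
pose s := (r - one *m A) *m pinvmx A.
have sA : s *m A = r - one *m A.
  by rewrite mulmxKpV// addmx_sub// eqmx_opp submxMl.
have rE : r = (one + s) *m A by rewrite mulmxDl sA addrC subrK.
rewrite rE lin_comb_mulmx; apply: convex_cone_sum => // i.
have := WP _ Wv i; rewrite -/s ltr_norml => /andP[+ _].
rewrite !mxE; lra.
Qed.

(** * Hilbert spaces: projections and sequential normal compactness *)

Section Hilbert.
Variables (R : realType) (X : completeNormedModType R) (dot : {dot X for idfun}).
Hypothesis dot_norm : induces_norm dot.
Implicit Types (Omega L : set X) (x y z u v n : X).

Let dotC u v : dot u v = dot v u.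
Proof. by rewrite [LHS](hermC dot) expr0 mul1r. Qed.

Let dotZl (a : R) u v : dot (a *: u) v = a * dot u v.
Proof. by rewrite linearZl_LR. Qed.

Let dotZr (a : R) u v : dot u (a *: v) = a * dot u v.
Proof. by rewrite dotC dotZl dotC. Qed.

Let dotDr u v w : dot u (v + w) = dot u v + dot u w.
Proof. by rewrite linearDr. Qed.

Let normD_sqr u v : `|u + v| ^+ 2 = `|u| ^+ 2 + 2 * dot u v + `|v| ^+ 2.
Proof.
rewrite !dot_norm linearDl !linearDr/= (dotC v u); ring.
Qed.

Let normB_sqr u v : `|u - v| ^+ 2 = `|u| ^+ 2 - 2 * dot u v + `|v| ^+ 2.
Proof. by rewrite normD_sqr normrN linearNr mulrN. Qed.

(** Cauchy-Schwarz, from |v - <n, v> n|^2 >= 0. *)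
Lemma dot_unit_le n v : `|n| = 1 -> `|dot n v| <= `|v|.
Proof.
move=> n1; rewrite -ler_sqr ?nnegrE// real_normK ?num_real//.
have := sqr_ge0 `|v - dot n v *: n|.
rewrite normB_sqr dotZr normrZ exprMn n1 real_normK ?num_real// (dotC v n).
lra.
Qed.

Lemma dot_unit_continuous n : `|n| = 1 -> continuous (dot n : X -> R^o).
Proof.
move=> n1 v; apply/cvgrPdist_lt => e e0; near=> w.
rewrite -linearBr (le_lt_trans (dot_unit_le _ n1))//.
Unshelve. all: by end_near. Qed.

(** The value 1 is taken at [n] itself; Cauchy-Schwarz bounds the set, so its [sup] is an actual
    upper bound. *)
Lemma dual_norm_unit n : `|n| = 1 -> 1 <= dual_norm (dot n).
Proof.
move=> n1; apply: ub_le_sup => /=.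
  by exists 1 => _ [x /= x1 <-]; rewrite (le_trans (dot_unit_le _ n1)).
by exists n; rewrite /= ?n1// -dot_norm n1 expr1n normr1.
Qed.

(** The near-minimizers generate a Cauchy filter, whose limit lies in the closed set and attains the
    infimum. *)
Lemma min_dist_exists Omega z : convex_set Omega -> closed Omega ->
  Omega !=set0 -> exists2 p, Omega p & forall y, Omega y -> `|z - p| <= `|z - y|.
Proof.
move=> /convex_setP cO clO [y0 Oy0].
pose D := [set `|z - y| | y in Omega]; pose d := inf D.
have infD : has_inf D.
  by split; [exists `|z - y0|, y0|exists 0 => _ [y _ <-]].
have d_le y : Omega y -> d <= `|z - y|.
  by move=> Oy; apply: ge_inf; [exact: infD.2|exists y].
have d_ge0 : 0 <= d by apply: lb_le_inf; [exact: infD.1|move=> _ [y _ <-]].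
pose A (e : R) := [set y | Omega y /\ `|z - y| < d + e].
pose F := filter_from [set e : R | 0 < e] A.
have FF : ProperFilter F.
  apply: filter_from_proper.
    apply: filter_from_filter; first by exists 1 => /=.
    move=> i j /= i0 j0; exists (Num.min i j); first by rewrite /= lt_min i0.
    move=> y [Oy]; rewrite addr_minr lt_min => /andP[yi yj]; do 2 split=> //.
  move=> e /= e0; have [_ [y Oy <-] ye] := inf_adherent e0 infD.
  by exists y.
(* Parallelogram identity, the midpoint of y and y' being at distance at least d from z. *)
have dist_sqr a y y' : 0 < a -> A a y -> A a y' ->
    `|y - y'| ^+ 2 < 4 * ((d + a) ^+ 2 - d ^+ 2).
  move=> a0 [Oy ya] [Oy' ya'].
  have h01 : 0 <= (2^-1 : R) <= 1 by lra.
  have /andP[h0 h1] := h01.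
  have := d_le _ (cO _ _ _ h0 h1 Oy Oy').
  have -> : z - (2^-1 *: y + (1 - 2^-1) *: y') = 2^-1 *: ((z - y) + (z - y')).
    have -> : (1 - 2^-1 : R) = 2^-1 by field.
    rewrite addrACA -opprD scalerBr !scalerDr -scalerDl.
    have -> : (2^-1 + 2^-1 : R) = 1 by field.
    by rewrite scale1r.
  rewrite -ler_sqr ?nnegrE// normrZ exprMn (normD_sqr (z - y)) ger0_norm// => dm.
  have -> : y - y' = (z - y') - (z - y).
    by rewrite opprB [RHS]addrC addrA subrK.
  rewrite normB_sqr (dotC (z - y')).
  have : `|z - y| ^+ 2 < (d + a) ^+ 2 by rewrite ltr_sqr ?nnegrE// addr_ge0// ltW.
  have : `|z - y'| ^+ 2 < (d + a) ^+ 2 by rewrite ltr_sqr ?nnegrE// addr_ge0// ltW.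
  lra.
have : cvg F.
  apply: cauchy_cvg; apply: cauchy_exP => e e0.
  (* As a <= 1, 4((d + a)^2 - d^2) = 4a(2d + a) <= a(8d + 4) <= e^2. *)
  pose a := Num.min 1 (e ^+ 2 / (8 * d + 4)).
  have d8 : 0 < 8 * d + 4 by lra.
  have a0 : 0 < a by rewrite lt_min ltr01 divr_gt0// exprn_gt0.
  have [y Ay] : exists y, A a y.
    have [_ [y Oy <-] ye] := inf_adherent a0 infD.
    by exists y.
  exists y; exists a => // y' Ay'; rewrite -ball_normE /ball_/=.
  rewrite -ltr_sqr ?nnegrE// ?ltW// (lt_le_trans (dist_sqr _ _ _ a0 Ay Ay'))//.
  have a1 : a <= 1 by rewrite /a ge_min lexx.
  have : a <= e ^+ 2 / (8 * d + 4) by rewrite /a ge_min lexx orbT.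
  rewrite ler_pdivlMr// => ae.
  nra.
move=> /cvg_ex[p Fp]; exists p.
  apply: (@closed_cvg _ _ F FF id Omega clO _ p) => //.
  by exists 1 => [|y []]; rewrite /= ?ltr01.
move=> y Oy; rewrite (le_trans _ (d_le _ Oy))//; apply/ler_addgt0Pr => e e0.
have e2 : 0 < e / 2 by lra.
have nA : F (A (e / 2)) by exists (e / 2).
have nB : F (ball p (e / 2)) by apply: Fp; exact: nbhsx_ballx.
have [w [[Ow dw] pw]] := filter_ex (filterI nA nB).
move: pw; rewrite -ball_normE /ball_/= distrC => pw.
rewrite -[z - p](subrKA w) (le_trans (ler_normD _ _))//; lra.
Qed.

Lemma projection_exists Omega z : convex_set Omega -> closed Omega ->
  Omega !=set0 -> exists p, [/\ Omega p,
    forall y, Omega y -> `|z - p| <= `|z - y| &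
    forall y, Omega y -> dot (z - p) (y - p) <= 0].
Proof.
move=> cO clO O0; have [p Op pmin] := min_dist_exists z cO clO O0.
exists p; split=> // y Oy; rewrite leNgt; apply/negP => D_gt0.
set D := dot _ _ in D_gt0; set N := `|y - p| ^+ 2.
have N_ge0 : 0 <= N by rewrite exprn_ge0.
have DN : 0 < D + N by lra.
(* Minimality of [p], tested at p + t(y - p), gives 2tD <= t^2 N, whereas this t satisfies tN = D -
   tD < D. *)
pose t := D / (D + N).
have t_gt0 : 0 < t by rewrite divr_gt0.
have t_le1 : t <= 1 by rewrite ler_pdivrMr// mul1r lerDl.
have := pmin _ (convex_setP cO (ltW t_gt0) t_le1 Oy Op).
have -> : z - (t *: y + (1 - t) *: p) = (z - p) - t *: (y - p).
  rewrite scalerBr scalerBl scale1r !opprD !opprK -!addrA; congr (_ + _).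
  by rewrite addrCA.
rewrite -ler_sqr ?nnegrE// (normB_sqr (z - p)) dotZr normrZ exprMn.
rewrite (ger0_norm (ltW t_gt0)) -/D -/N => H.
have tDN : t * (D + N) = D by rewrite divfK// gt_eqF.
nra.
Qed.

Lemma linear_subspace_convex L : linear_subspace L -> convex_set L.
Proof.
move=> sL; apply/convex_setW => u v; rewrite !inE => Lu Lv t _ _.
rewrite inE; have /linear_subspaceP[L0 LZD] := sL.
have := LZD t%:num _ _ Lu (LZD (1 - t%:num) _ _ Lv L0).
by rewrite addr0.
Qed.

(** On a subspace the variational inequality holds at both q + l and q - l, hence is an equality. *)
Lemma orthogonal_projection_exists L y : linear_subspace L -> closed L ->
  exists2 q, L q & forall l, L l -> dot l (y - q) = 0.
Proof.
move=> sL clL; have /linear_subspaceP[L0 _] := sL.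
have [q [Lq _ qL]] := projection_exists y (linear_subspace_convex sL) clL
  (ex_intro _ 0 L0).
have [_ LD _] := linear_subspace_convex_cone sL.
exists q => // l Ll; rewrite dotC; apply/eqP; rewrite eq_le.
have := qL _ (LD _ _ Ll Lq); rewrite addrK => ->/=.
have := qL _ (LD _ _ (linear_subspaceN sL Ll) Lq).
by rewrite addrK linearNr oppr_le0.
Qed.

(* Unit normals in [L] at points tending to [x] converge weakly-* to [0]: they are
   asymptotically nonpositive on the cone of [Omega - x], hence on its closure [L],
   hence vanish asymptotically on the subspace [L], and vanish on its orthogonal. *)
Lemma unit_normals_weak_star_cvg0 Omega x (p n : nat -> X) :
  let L := closure (cone (translate Omega x)) in
  linear_subspace L -> p @ \oo --> x -> (forall k, L (n k)) ->
  (forall k, `|n k| = 1) -> (forall k, normal_cone (p k) Omega (dot (n k))) ->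
  weak_star_cvg0 (fun k => dot (n k)).
Proof.
move=> L sL px Ln n1 nN.
have small l (e : R) : L l -> 0 < e -> \forall k \near \oo, dot (n k) l < e.
  move=> Ll e0; have e2 : 0 < e / 2 by lra.
  have [c [[t [_ [t0 [a Oa <-] cE]]] ballc]] := Ll _ (nbhsx_ballx l _ e2).
  move: ballc; rewrite -ball_normE /ball_/= => lc.
  have t1 : 0 < t + 1 by lra.
  have e2t : 0 < e / 2 / (t + 1) by rewrite divr_gt0.
  near=> k.
  have pk : `|x - p k| < e / 2 / (t + 1).
    by near: k; move/cvgrPdist_lt: px; exact.
  have lcn := le_lt_trans (ler_norm _) (le_lt_trans (dot_unit_le (l - c) (n1 k)) lc).
  (* Split l as (l - c) + t(a - p k) + t(p k - x): the outer terms contribute less than e/2 each,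
     the middle one is nonpositive by normality. *)
  rewrite -(subrK c l) dotDr [in X in _ + X]cE dotZr.
  rewrite -(subrKA (p k) a (- x)) (dotDr _ (a - _)).
  have nk := (nN k).2 _ Oa.
  have := le_trans (ler_norm _) (dot_unit_le (p k - x) (n1 k)).
  rewrite distrC => pxn.
  move: pk; rewrite ltr_pdivlMr// => pk.
  have : t * dot (n k) (a - p k) <= 0 by exact: mulr_ge0_le0.
  have : t * dot (n k) (p k - x) <= t * `|x - p k| by exact: ler_wpM2l.
  have := normr_ge0 (x - p k).
  move: lcn pk.
  set u1 := dot _ _; set u2 := dot _ _; set u3 := dot _ _.
  lra.
apply/pointwise_cvgP => y /=.
suff : (dot (n k) y : R^o) @[k --> \oo] --> (0 : R^o) by [].
apply/cvgrPdist_lt => e e0.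
(* Only the component [q] of [y] in [L] counts; [small] at [q] and at [- q] bounds the absolute
   value. *)
have [q Lq qP] := orthogonal_projection_exists y sL (@closed_closure _ _).
near=> k; have -> : dot (n k) y = dot (n k) q.
  by rewrite -[in LHS](subrK q y) dotDr qP// add0r.
rewrite sub0r normrN ltr_norml ltrNl -linearNr.
apply/andP; split; near: k; apply: small => //.
exact: (linear_subspaceN sL).
Unshelve. all: by end_near. Qed.

Lemma snc_ball_sub Omega x : convex_set Omega -> closed Omega -> Omega x ->
  snc_at Omega x ->
  let L := closure (cone (translate Omega x)) in
  linear_subspace L ->
  exists2 e : R, 0 < e & forall z, L z -> `|z| < e -> Omega (x + z).
Proof.
move=> cO clO Ox snc L sL; apply: contrapT => noball.
have /choice[z zP] : forall k : nat,
    exists z, [/\ L z, `|z| < k.+1%:R^-1 & ~ Omega (x + z)].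
  move=> k; apply: contrapT => noz; apply: noball; exists k.+1%:R^-1.
    by rewrite invr_gt0.
  by move=> z Lz zk; apply: contrapT => nOz; apply: noz; exists z.
have /choice[p pP] : forall k, exists p, [/\ Omega p,
    forall y, Omega y -> `|x + z k - p| <= `|x + z k - y| &
    forall y, Omega y -> dot (x + z k - p) (y - p) <= 0].
  by move=> k; apply: projection_exists => //; exists x.
pose r k := x + z k - p k; pose n k := `|r k|^-1 *: r k.
have r_gt0 k : 0 < `|r k|.
  rewrite normr_gt0 subr_eq0; apply/eqP => xzp.
  by have [_ _] := zP k; rewrite xzp; apply; have [] := pP k.
have n1 k : `|n k| = 1 by rewrite normrZ normrV ?normr_id ?mulVf ?unitfE ?gt_eqF.
(* As [x] is in [Omega], |x + z k - p k| <= |z k|, whence |x - p k| <= 2|z k|. *)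
have px : p @ \oo --> x.
  apply/cvgrPdist_lt => e e0; have e2 : 0 < e / 2 by lra.
  near=> k; have [_ zk _] := zP k; have [_ /(_ _ Ox)] := pP k.
  rewrite (addrC x) addrK => pz _.
  have -> : x - p k = (z k + x - p k) - z k by rewrite addrAC [_ + x]addrC addrK.
  rewrite (le_lt_trans (ler_normB _ _))//.
  have : `|z k| < e / 2.
    by apply: lt_trans zk _; near: k; exact: (near_infty_natSinv_lt (PosNum e2)).
  lra.
have Ln k : L (n k).
  have [L0 LD LZ] := linear_subspace_convex_cone sL.
  apply: LZ; first by rewrite invr_ge0.
  have [Lz _ _] := zP k; have [Op _ _] := pP k.
  have -> : r k = z k - (p k - x) by rewrite opprB /r [x + _]addrC addrA.
  apply: (linear_subspaceB sL) => //; apply: subset_closure.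
  exact: mem_cone_translate.
have nN k : normal_cone (p k) Omega (dot (n k)).
  split; first exact: dot_unit_continuous.
  move=> y Oy; have [_ _ /(_ _ Oy)] := pP k.
  by move=> ?; rewrite /n /= dotZl mulr_ge0_le0// invr_ge0.
have Op k : Omega (p k) by have [] := pP k.
(* Compactness sends the dual norms to 0, although each is at least 1. *)
have /cvgrPdist_lt/(_ _ ltr01) := snc p (fun k => dot (n k)) Op px nN
  (unit_normals_weak_star_cvg0 sL px Ln n1 nN).
move=> [k _ /(_ k (leqnn k))]/=; rewrite sub0r normrN => /(le_lt_trans (ler_norm _)).
by rewrite ltNge dual_norm_unit.
Unshelve. all: by end_near. Qed.

Lemma snc_quasi_regular Omega : convex_set Omega -> closed Omega -> snc Omega ->
  quasi_regular Omega.
Proof.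
move=> cO clO sncO; apply: quasi_regularP => // x Ox sL.
have [e e0 eO] := snc_ball_sub cO clO Ox (sncO _ Ox) sL.
exists 0, (ball 0 e); split.
- by have [] := cone_convex_cone cO Ox.
- exact: nbhsx_ballx.
- move=> z []; rewrite -ball_normE /ball_/= sub0r normrN => ze Lz.
  by rewrite -(addKr x z) addrC; apply: mem_cone_translate; exact: eO.
Qed.

End Hilbert.

Theorem theorem3p8 (R : realType) :
  [/\ forall (X : tvsType R) (Omega : set X),
        hausdorff_space X -> finite_dimensional X ->
        Omega !=set0 -> convex_set Omega ->
        quasi_regular Omega,
      forall (X : tvsType R) (Omega : set X),
        Omega !=set0 -> convex_set Omega ->
        interior Omega !=set0 ->
        quasi_regular Omega,
      forall (X : tvsType R) (Omega : set X),
        Omega !=set0 -> convex_set Omega ->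
        ri Omega !=set0 ->
        quasi_regular Omega
    & forall (X : completeNormedModType R) (dot : {dot X for idfun})
             (Omega : set X),
        induces_norm dot ->
        Omega !=set0 -> convex_set Omega ->
        closed Omega -> snc Omega -> iri Omega !=set0 ->
        quasi_regular Omega].
Proof.
split.
- move=> X Omega hausX fdX _ cO; exact: finite_dimensional_quasi_regular.
- move=> X Omega _ cO [x Ox]; apply: ri_quasi_regular => //.
  by exists x; exact: interior_sub_ri.
- by move=> X Omega _ cO riO; exact: ri_quasi_regular.
- move=> X dot Omega dot_norm _ cO clO sncO _; exact: (snc_quasi_regular dot_norm).
Qed.
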